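(* Let $A$ be a finite dimensional algebra over an algebraically closed field $\mathbb{K}$ of characteristic zero and let $D:A\to A$ be an automorphism of algebras of finite order $m$. Let $r\in\mathbb{K}$ be an element of multiplicative order $2m$ if $m$ is even and of multiplicative order $m$ if $m$ is odd, and let $q=r^2$. Let $\mathcal{E}=\{0\le i\le m-1: q^i\in\operatorname{Spec}(D)\}$ and, for $i\in\mathcal{E}$, $E_{D,q^i}=\{x\in A: Dx=q^ix\}$. For each $i\in\mathcal{E}$ take an arbitrary direct sum decomposition into subspaces $E_{D,q^i}=V_{+,i}\oplus V_{-,i}$, and define the linear transformation $\sigma$ on $A$ by $\sigma|_{V_{\pm,i}}=\pm r^i\operatorname{id}$ for all $i\in\mathcal{E}$. Then $\sigma^2=D$. Moreover, $\sigma$ is an automorphism of algebras if and only if the following conditions hold: (1) $1\in V_{+,0}$; (2) for all $i,j\in\mathcal{E}$: (a) if $0\le i+j\le m-1$, then $V_{+,i}V_{+,j}+V_{-,i}V_{-,j}\subseteq V_{+,i+j}$ and $V_{+,i}V_{-,j}+V_{-,i}V_{+,j}\subseteq V_{-,i+j}$; (b) if $m\le i+j\le 2m-2$, then: (i) if $m$ is even, $V_{+,i}V_{+,j}+V_{-,i}V_{-,j}\subseteq V_{-,i+j-m}$ and $V_{+,i}V_{-,j}+V_{-,i}V_{+,j}\subseteq V_{+,i+j-m}$; (ii) if $m$ is odd, $V_{+,i}V_{+,j}+V_{-,i}V_{-,j}\subseteq V_{+,i+j-m}$ and $V_{+,i}V_{-,j}+V_{-,i}V_{+,j}\subseteq 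V_{-,i+j-m}$.
   Context: Algebras are associative and unital, and automorphisms of algebras preserve the unit. $\operatorname{Spec}(D)$ is the set of eigenvalues of $D$. For $0\le k\le m-1$ with $k\notin\mathcal{E}$ one sets $V_{+,k}=V_{-,k}=\{0\}$. For subspaces $U,W$ of $A$, $UW$ denotes the linear span of the products $uw$, $u\in U$, $w\in W$. Note that $q$ has order $m$ and $A=\bigoplus_{i\in\mathcal{E}}E_{D,q^i}$, so $\sigma$ is well defined. *)

(* Defs.v *)
From mathcomp Require Import all_boot all_order all_algebra all_field.

Set Implicit Arguments.
Unset Strict Implicit.
Unset Printing Implicit Defensive.

Import GRing.Theory.
Local Open Scope ring_scope.

(* [ahom_in {:A} f] says that [f] is multiplicative and that [f 1 = 1]. *)
Definition alg_automorphism (K : fieldType) (A : falgType K)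
    (f : 'End(A)) : Prop :=
  ahom_in {:A} f /\ bijective f.

Definition has_finite_order (T : Type) (f : T -> T) (m : nat) : Prop :=
  [/\ (0 < m)%N, iter m f =1 id &
      forall k : nat, (0 < k < m)%N -> ~ (iter k f =1 id)].

Definition spec_exponents (K : fieldType) (A : falgType K)
    (D : 'End(A)) (q : K) (m : nat) : pred nat :=
  [pred i | (i < m)%N && passmx.leigenvalue D (q ^+ i)].

(* The families are indexed by [nat], but only the indices below [m] are
   constrained. *)
Definition eigenspace_splitting (K : fieldType) (A : falgType K)
    (D : 'End(A)) (q : K) (m : nat) (Vp Vm : nat -> {vspace A}) : Prop :=
  (forall i : nat, i \in spec_exponents D q m ->
     passmx.leigenspace D (q ^+ i) = (Vp i + Vm i)%VS /\ directv (Vp i + Vm i)) /\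
  (forall k : nat, (k < m)%N -> k \notin spec_exponents D q m ->
     Vp k = 0%VS /\ Vm k = 0%VS).

(* The eigenspaces of [D] at the [q ^+ i] span [A] when [D] has finite order
   [m] and [q] is a primitive [m]-th root of unity, so these equations
   determine the linear map [sigma]. *)
Definition acts_by_signed_powers (K : fieldType) (A : falgType K)
    (D : 'End(A)) (q r : K) (m : nat) (Vp Vm : nat -> {vspace A})
    (sigma : 'End(A)) : Prop :=
  forall i : nat, i \in spec_exponents D q m ->
    (forall x : A, x \in Vp i -> sigma x = r ^+ i *: x) /\
    (forall x : A, x \in Vm i -> sigma x = - (r ^+ i) *: x).

(* Main.v *)
Require Import Defs.
From mathcomp Require Import all_boot all_order all_algebra all_field.

Set Implicit Arguments.
Unset Strict Implicit.
Unset Printing Implicit Defensive.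

Import GRing.Theory.
Local Open Scope ring_scope.

(** The subspaces [Vp i] and [Vm i], for [i < m], are exactly the eigenspaces
    of [sigma] at [r ^+ i] and [- r ^+ i], and together they span [A].

    They span because the polynomial ['X^m - 1], which annihilates [D], has the
    [m] distinct roots [q ^+ i]; explicitly, averaging the [q ^+ (- i * k)] times
    [D ^ k] over [k] projects onto the eigenspace of [D] at [q ^+ i]
    ([sum_leigenspace_finite_order]).  A property stable under sums can thus be
    checked on the vectors of the [Vp i] and [Vm i] ([signed_part_ind]), and this
    gives [sigma \o sigma = D] at once, since [(+- r ^+ i) ^+ 2 = q ^+ i].
    Conversely an eigenvector of [sigma] at [+- r ^+ i] is an eigenvector of [D]
    at [q ^+ i]; it splits in [Vp i + Vm i], and the component of the wrong sign
    is killed by [2 * r ^+ i], which is invertible in characteristic zero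
    ([signed_partP]).

    Multiplicativity of [sigma] on eigenvectors [u], [v] with eigenvalues [a],
    [b] says that [u * v] is an eigenvector with eigenvalue [a * b].  When
    [a = +- r ^+ i] and [b = +- r ^+ j], the product [a * b] has the form
    [+- r ^+ k] with [k < m]: if [i + j >= m] one must take out the factor
    [r ^+ m], which is [1] for odd [m] and [-1] for even [m]
    ([expr_half_order]).  This factor is the sign swap between the cases for odd
    and even [m] ([alg_automorphism_signed_part]). *)

(** * Roots of unity and eigenspaces *)

Lemma sqr_half_order_prim_root (K : fieldType) (r : K) (m : nat) :
  (if odd m then m else (2 * m)%N).-primitive_root r ->
  m.-primitive_root (r ^+ 2).
Proof.
case: ifP => odd_m /exp_prim_root/(_ 2).
  by rewrite (eqP (_ : coprime 2 m)) ?divn1 // coprime2n.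
by rewrite gcdnMr mulKn.
Qed.

Lemma expr_half_order (K : fieldType) (r : K) (m : nat) :
  (if odd m then m else (2 * m)%N).-primitive_root r ->
  r ^+ m = (-1) ^+ ~~ odd m.
Proof.
case: ifP => odd_m prim_r; first exact: prim_expr_order.
have m2_gt0 := prim_order_gt0 prim_r.
have /eqP := prim_expr_order prim_r.
rewrite mulnC exprM sqrf_eq1 => /orP[rm1|/eqP-> //].
(* [r ^+ m = 1] would make [2 * m] divide [m]. *)
move: m2_gt0 rm1; rewrite -(prim_order_dvd prim_r) muln_gt0 /= => m_gt0.
by move/(dvdn_leq m_gt0); rewrite leqNgt ltn_Pmull.
Qed.

Lemma mem_leigenspace (K : fieldType) (V : vectType K) (f : 'End(V)) (a : K)
    (x : V) : (x \in passmx.leigenspace f a) = (f x == a *: x).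
Proof.
by rewrite memv_ker !lfunE /= !lfunE /= scale_lfunE id_lfunE subr_eq0.
Qed.

(** The vector [\sum_(k < n) q ^- (i * k) *: iter k f x] is an eigenvector at
    [q ^+ i], because [f] permutes its terms cyclically up to that factor; by
    orthogonality of the powers of [q], these vectors add up to [n *: x]. *)
Lemma sum_leigenspace_finite_order (K : fieldType) (V : vectType K)
    (f : 'End(V)) (n : nat) (q : K) :
  n.-primitive_root q -> iter n f =1 id ->
  (\sum_(i < n) passmx.leigenspace f (q ^+ i))%VS = fullv.
Proof.
move=> prim_q fn1; apply/vspaceP => x; rewrite memvf.
have q_neq0 : q != 0.
  by rewrite (prim_root_eq0 prim_q) -lt0n (prim_order_gt0 prim_q).
have n_neq0 : n%:R != 0 :> K := prim_root_natf_neq0 prim_q.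
pose F i k := q ^- (i * k) *: iter k f x.
have eigF i : \sum_(k < n) F i k \in passmx.leigenspace f (q ^+ i).
  rewrite mem_leigenspace linear_sum scaler_sumr /=; apply/eqP.
  transitivity (\sum_(k < n) q ^+ i *: F i k.+1).
    apply: eq_bigr => k _; rewrite /F linearZ /= scalerA mulnS exprD invfM mulrA.
    by rewrite divff ?mul1r // expf_neq0.
  case: (n) fn1 prim_q => [|p] fp1 prim_q; first by rewrite !big_ord0.
  rewrite big_ord_recr [RHS]big_ord_recl addrC /=; congr (_ + _); congr (_ *: _).
  rewrite /F muln0 mulnC exprM (prim_expr_order prim_q) expr1n expr0.
  by congr (_ *: _); exact: fp1.
have sumF : \sum_(i < n) \sum_(k < n) F i k = n%:R *: x.
  rewrite exchange_big (bigD1 (Ordinal (prim_order_gt0 prim_q))) //=.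
  rewrite [X in _ + X]big1 ?addr0 => [|k k_neq0].
    rewrite (eq_bigr (fun=> x)) => [|i _]; last first.
      by rewrite /F muln0 expr0 invr1 scale1r.
    by rewrite sumr_const card_ord scaler_nat.
  rewrite -scaler_suml (eq_bigr (fun i : 'I_n => (q ^- k) ^+ i)) => [|i _];
    last by rewrite mulnC exprM exprVn.
  suff /eqP-> : \sum_(i < n) (q ^- k) ^+ i == 0 by rewrite scale0r.
  have : (q ^- k - 1) * (\sum_(i < n) (q ^- k) ^+ i) == 0.
    by rewrite -subrX1 exprVn -exprM mulnC exprM (prim_expr_order prim_q) expr1n
      invr1 subrr.
  have k_gt0 : (0 < k)%N.
    by rewrite lt0n; apply: contraNneq k_neq0 => k0; apply/eqP/val_inj.
  by rewrite mulf_eq0 subr_eq0 invr_eq1 -(prim_order_dvd prim_q) gtnNdvd.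
rewrite -[x]scale1r -(mulVf n_neq0) -scalerA -sumF memvZ //.
by apply: memv_sumr => i _; exact: eigF.
Qed.

(** * The eigenspaces of the square root *)

Section SignedRoot.

Variables (K : fieldType) (A : falgType K) (D : 'End(A)) (m : nat) (r : K).
Variables (Vp Vm : nat -> {vspace A}) (sigma : 'End(A)).

Hypothesis charK : [pchar K] =i pred0.
Hypothesis autD : alg_automorphism D.
Hypothesis ordD : has_finite_order D m.
Hypothesis ord_r : (if odd m then m else (2 * m)%N).-primitive_root r.
Hypothesis splitV : eigenspace_splitting D (r ^+ 2) m Vp Vm.
Hypothesis def_sigma : acts_by_signed_powers D (r ^+ 2) r m Vp Vm sigma.

Let q := r ^+ 2.

(** Signs are recorded as booleans, so that multiplying them is [addb]. *)
Definition signed_part (s : bool) (i : nat) := if s then Vm i else Vp i.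

Lemma leigenspace_signed_parts i : (i < m)%N ->
  passmx.leigenspace D (q ^+ i) = (Vp i + Vm i)%VS.
Proof.
move=> lt_im; case: splitV => splitE splitN.
have [/splitE[]//|nEi] := boolP (i \in spec_exponents D q m).
have [-> ->] := splitN _ lt_im nEi.
by move: nEi; rewrite inE lt_im /= negbK addv0 => /eqP.
Qed.

Lemma signed_part_leigenspace s i x : (i < m)%N -> x \in signed_part s i ->
  D x = q ^+ i *: x.
Proof.
move=> lt_im Vx; apply/eqP; rewrite -mem_leigenspace leigenspace_signed_parts //.
by apply: subvP Vx; case: s; rewrite ?addvSl ?addvSr.
Qed.

Lemma sigma_signed_part s i x : (i < m)%N -> x \in signed_part s i ->
  sigma x = ((-1) ^+ s * r ^+ i) *: x.
Proof.
move=> lt_im; have [/def_sigma[sp sm]|nEi] := boolP (i \in spec_exponents D q m).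
  by case: s => Vx; rewrite ?(sm _ Vx) ?(sp _ Vx) ?mulN1r ?mul1r.
have [_ /(_ _ lt_im nEi)[V0 W0]] := splitV.
by rewrite /signed_part V0 W0 if_same memv0 => /eqP->; rewrite linear0 scaler0.
Qed.

(** Replaces choosing a basis of eigenvectors when checking linear identities. *)
Lemma signed_part_ind (P : A -> Prop) :
  (forall x y, P x -> P y -> P (x + y)) ->
  (forall s i x, (i < m)%N -> x \in signed_part s i -> P x) ->
  forall x, P x.
Proof.
move=> PD PV x; have [m_gt0 Dm1 _] := ordD.
have := memvf x.
rewrite -(sum_leigenspace_finite_order (sqr_half_order_prim_root ord_r) Dm1).
case/memv_sumP => xs Exs ->; apply: (big_ind P) => // [|i _].
  by apply: (PV false 0%N) => //; exact: mem0v.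
move: (Exs i isT); rewrite leigenspace_signed_parts ?ltn_ord //.
case/memv_addP => y Vy [z Vz ->].
by apply: PD; [apply: (PV false i) | apply: (PV true i)].
Qed.

Lemma sigma_sqr x : sigma (sigma x) = D x.
Proof.
elim/signed_part_ind: x => [x y sx sy|s i x lt_im Vx].
  by rewrite !linearD /= sx sy.
rewrite (sigma_signed_part lt_im Vx) linearZ /= (sigma_signed_part lt_im Vx).
rewrite (signed_part_leigenspace lt_im Vx) scalerA -expr2 exprMn.
by rewrite sqrr_sign mul1r /q -!exprM mulnC.
Qed.

(** A [sigma]-eigenvector at [+- r ^+ i] lies in [Vp i + Vm i] because [D] is the
    square of [sigma]; its component of the other sign vanishes as [2] is
    invertible. *)
Lemma signed_partP s i x : (i < m)%N ->
  (x \in signed_part s i) = (sigma x == ((-1) ^+ s * r ^+ i) *: x).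
Proof.
move=> lt_im; apply/idP/eqP => [|sx]; first exact: sigma_signed_part.
have: x \in (signed_part s i + signed_part (~~ s) i)%VS.
  have: x \in passmx.leigenspace D (q ^+ i).
    rewrite mem_leigenspace -sigma_sqr sx linearZ /= sx scalerA -expr2 exprMn.
    by rewrite sqrr_sign mul1r /q -!exprM mulnC.
  by rewrite leigenspace_signed_parts //; case: (s) => //=; rewrite addvC.
case/memv_addP => y Vy [z Vz def_x]; move/eqP: sx.
rewrite def_x linearD /= (sigma_signed_part lt_im Vy) (sigma_signed_part lt_im Vz).
rewrite scalerDr (inj_eq (addrI _)) signrN mulNr scaleNr eq_sym -addr_eq0.
rewrite -scalerDl -mulr2n -mulr_natl scaler_eq0 !mulf_eq0 signr_eq0.
rewrite (pcharf0P K).1 //=.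
have r_neq0 : r != 0.
  rewrite (prim_root_eq0 ord_r) -lt0n; exact: prim_order_gt0 ord_r.
by rewrite (negPf (expf_neq0 _ r_neq0)) /= => /eqP->; rewrite addr0.
Qed.

(** * Multiplicativity *)

(** Bijectivity is automatic: [sigma] commutes with its square [D], so composing
    it with the inverse of [D] gives a two-sided inverse.  Multiplicativity
    extends from eigenvectors by bilinearity. *)
Lemma alg_automorphism_sigma :
  alg_automorphism sigma <->
  sigma 1 = 1 /\ (forall s t i j u v, (i < m)%N -> (j < m)%N ->
    u \in signed_part s i -> v \in signed_part t j ->
    sigma (u * v) = sigma u * sigma v).
Proof.
split=> [[/ahom_inP[sM s1] _]|[s1 sM]].
  by split=> // *; rewrite sM ?memvf.
split; last first.
  have [_ [D' DK D'K]] := autD.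
  exists (D' \o sigma) => x /=; first by rewrite sigma_sqr DK.
  have sD y : sigma (D y) = D (sigma y) by rewrite -!sigma_sqr.
  by rewrite -[X in sigma (D' (sigma X))]D'K sD DK sigma_sqr D'K.
apply/ahom_inP; split=> // x y _ _.
elim/signed_part_ind: x => [x x' IHx IHx'|s i u lt_im Vu].
  by rewrite mulrDl !linearD /= mulrDl IHx IHx'.
elim/signed_part_ind: y => [y y' IHy IHy'|t j v lt_jm Vv].
  by rewrite mulrDr !linearD /= mulrDr IHy IHy'.
exact: sM lt_im lt_jm Vu Vv.
Qed.

(** For [i + j = k + m], the factor [r ^+ m] taken out of [r ^+ i * r ^+ j] is
    [-1] exactly when [m] is even; the boolean [carry] tells whether it occurs. *)
Lemma sigma_mul_signed_part s t i j k (carry : bool) u v :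
  (i < m)%N -> (j < m)%N -> (k < m)%N -> (i + j = k + carry * m)%N ->
  u \in signed_part s i -> v \in signed_part t j ->
  (u * v \in signed_part (s (+) t (+) (carry && ~~ odd m)) k) =
  (sigma (u * v) == sigma u * sigma v).
Proof.
move=> lt_im lt_jm lt_km def_ij Vu Vv; rewrite signed_partP //.
rewrite (sigma_signed_part lt_im Vu) (sigma_signed_part lt_jm Vv).
rewrite -scalerAl -scalerAr scalerA mulrACA -signr_addb -exprD def_ij exprD.
rewrite mulnC exprM (expr_half_order ord_r) -exprM mulnC mulnb.
by rewrite [r ^+ k * _]mulrC mulrA -signr_addb.
Qed.

(** The conditions in [i + j < m] and [i + j >= m], for either parity of [m], are
    the instances of one inclusion, obtained with [carry] false and true.  It
    ranges over all [i, j < m], since for non-exponents it says [0 <= _]. *)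
Lemma alg_automorphism_signed_part :
  alg_automorphism sigma <->
  1 \in Vp 0%N /\
  (forall s t i j k (carry : bool), (i < m)%N -> (j < m)%N -> (k < m)%N ->
    (i + j = k + carry * m)%N ->
    (signed_part s i * signed_part t j <=
     signed_part (s (+) t (+) (carry && ~~ odd m)) k)%VS).
Proof.
have [m_gt0 _ _] := ordD.
have V1 : (1 \in Vp 0%N) = (sigma 1 == 1).
  by rewrite -[Vp 0%N]/(signed_part false 0) signed_partP // expr0 mulr1 scale1r.
apply: (iff_trans alg_automorphism_sigma); rewrite V1.
split=> -[/eqP s1 sM]; split=> // s t i j.
  move=> k carry lt_im lt_jm lt_km def_ij; apply/prodvP => u v Vu Vv.
  rewrite (sigma_mul_signed_part lt_im lt_jm lt_km def_ij Vu Vv).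
  by apply/eqP; apply: sM lt_im lt_jm Vu Vv.
move=> u v lt_im lt_jm Vu Vv; apply/eqP.
have lt_km : ((i + j) %% m < m)%N by rewrite ltn_mod.
have def_ij : (i + j = (i + j) %% m + (m <= i + j) * m)%N.
  case: leqP => [le_m|lt_m]; last by rewrite modn_small ?addn0.
  rewrite -{2}(subnK le_m) modnDr modn_small ?mul1n ?subnK //.
  by rewrite ltn_subLR // -addnS leq_add // ltnW.
rewrite -(sigma_mul_signed_part lt_im lt_jm lt_km def_ij Vu Vv).
by move/prodvP: (sM s t _ _ _ _ lt_im lt_jm lt_km def_ij); apply.
Qed.

End SignedRoot.

Theorem theorem5p2 (K : closedFieldType) (charK : [pchar K] =i pred0)
    (A : falgType K) (D : 'End(A)) (m : nat)
    (autD : alg_automorphism D) (ordD : has_finite_order D m)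
    (r q : K)
    (ord_r : (if odd m then m else (2 * m)%N).-primitive_root r)
    (def_q : q = r ^+ 2)
    (Vp Vm : nat -> {vspace A})
    (splitV : eigenspace_splitting D q m Vp Vm)
    (sigma : 'End(A))
    (def_sigma : acts_by_signed_powers D q r m Vp Vm sigma) :
  (sigma \o sigma)%VF = D /\
  (alg_automorphism sigma <->
    (1 \in Vp 0%N /\
     forall i j : nat,
       i \in spec_exponents D q m -> j \in spec_exponents D q m ->
       ((i + j <= m - 1)%N ->
          (Vp i * Vp j + Vm i * Vm j <= Vp (i + j)%N)%VS /\
          (Vp i * Vm j + Vm i * Vp j <= Vm (i + j)%N)%VS) /\
       ((m <= i + j <= 2 * m - 2)%N ->
          (~~ odd m ->
             (Vp i * Vp j + Vm i * Vm j <= Vm (i + j - m)%N)%VS /\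
             (Vp i * Vm j + Vm i * Vp j <= Vp (i + j - m)%N)%VS) /\
          (odd m ->
             (Vp i * Vp j + Vm i * Vm j <= Vp (i + j - m)%N)%VS /\
             (Vp i * Vm j + Vm i * Vp j <= Vm (i + j - m)%N)%VS)))).
Proof.
subst q; have [m_gt0 _ _] := ordD; split.
  apply/lfunP => x; rewrite lfunE /=.
  exact: (sigma_sqr ordD ord_r splitV def_sigma).
apply: (iff_trans
  (alg_automorphism_signed_part charK autD ordD ord_r splitV def_sigma)).
split=> -[V1 VM]; split=> //.
  move=> i j /andP[lt_im _] /andP[lt_jm _].
  have incl := VM _ _ i j _ _ lt_im lt_jm.
  split=> [le_ij|/andP[le_m _]].
    have lt_ij : (i + j < m)%N by rewrite -(prednK m_gt0) ltnS -subn1.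
    have {}incl s t := incl s t (i + j)%N false lt_ij (esym (addn0 _)).
    by rewrite !subv_add (incl false false) (incl true true) (incl false true)
      (incl true false).
  have lt_k : (i + j - m < m)%N by rewrite ltn_subLR // -addSn leq_add // ltnW.
  have def_k : (i + j = i + j - m + true * m)%N by rewrite mul1n subnK.
  have {}incl s t := incl s t (i + j - m)%N true lt_k def_k.
  by split=> odd_m; rewrite ?odd_m ?(negPf odd_m) in incl; rewrite !subv_add
    (incl false false) (incl true true) (incl false true) (incl true false).
move=> s t i j k carry lt_im lt_jm lt_km def_ij.
(* An index that is no exponent of an eigenvalue contributes zero subspaces. *)
have part0 n u : (n < m)%N -> n \notin spec_exponents D (r ^+ 2) m ->
    signed_part Vp Vm u n = 0%VS.
  by move=> lt_nm /(splitV.2 _ lt_nm)[V0 W0]; case: u.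
have [Ei|nEi] := boolP (i \in spec_exponents D (r ^+ 2) m); last first.
  by rewrite (part0 i) // prod0v sub0v.
have [Ej|nEj] := boolP (j \in spec_exponents D (r ^+ 2) m); last first.
  by rewrite (part0 j) // prodv0 sub0v.
have [VMlt VMge] := VM i j Ei Ej.
case: carry def_ij => /= [|]; last first.
  rewrite addn0 => def_ij; move: VMlt; rewrite def_ij subn1 -ltnS (prednK m_gt0).
  rewrite !subv_add => /(_ lt_km)[/andP[? ?] /andP[? ?]].
  by case: s t => -[].
rewrite mul1n => def_ij.
have /VMge[] : (m <= i + j <= 2 * m - 2)%N.
  rewrite def_ij leq_addl /= -def_ij mul2n -addnn.
  rewrite -(prednK m_gt0) ltnS in lt_im lt_jm.
  by rewrite -(prednK m_gt0) addSn addnS subn2 /= leq_add.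
rewrite def_ij addnK !subv_add; case: (odd m) => /= [_ /(_ isT)|/(_ isT) + _].
  by case=> /andP[? ?] /andP[? ?]; case: s t => -[].
by case=> /andP[? ?] /andP[? ?]; case: s t => -[].
Qed.
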